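(* Let $R$ be a commutative unital ring, let $A$ and $B$ be unital associative $R$-algebras and let $M$ be a nonzero $(A,B)$-bimodule that is faithful as a left $A$-module and as a right $B$-module. Let $\mathcal{T}=\mathrm{Trian}(A,M,B)$ be the associated triangular algebra, and assume that $A$ and $B$ have only trivial idempotents. If $\sigma$ is a centralizing automorphism of $\mathcal{T}$, then $\sigma=\mathrm{Id}_{\mathcal{T}}$.
   Context: The triangular algebra $\mathrm{Trian}(A,M,B)$ is the set of all matrices $\begin{pmatrix} a & m\\ & b\end{pmatrix}$ with $a\in A$, $m\in M$, $b\in B$, which is a unital associative $R$-algebra under the usual matrix operations. Automorphisms are $R$-algebra automorphisms; $\mathrm{Id}_{\mathcal{T}}$ is the identity map. An algebra has only trivial idempotents if $0$ and $1$ are its only idempotents. A linear map $\Theta:\mathcal{A}\to\mathcal{A}$ of an algebra $\mathcal{A}$ is centralizing if $x\Theta(x)-\Theta(x)x$ lies in the center of $\mathcal{A}$ for all $x\in\mathcal{A}$. *)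

(* Defs.v *)
From HB Require Import structures.
From mathcomp Require Import all_boot all_order all_algebra.

Set Implicit Arguments.
Unset Strict Implicit.
Unset Printing Implicit Defensive.

Import GRing.Theory.
Local Open Scope ring_scope.

(* MathComp has no bimodules. The left A-action is the lmodType A structure,
   the right B-action is [ract]. Axiom [ractR] says that R acts in the same way
   through A and through B; without it Trian(A, M, B) is not an R-algebra. *)
HB.mixin Record Lmodule_isBimodule (R : comPzRingType) (A B : algType R) M
    of GRing.Lmodule A M := {
  ract : M -> B -> M;
  ractA : forall m b c, ract (ract m b) c = ract m (b * c);
  ract1 : forall m, ract m 1 = m;
  ractDl : forall b, {morph ract^~ b : m n / m + n};
  ractDr : forall m, {morph ract m : b c / b + c};
  ract_scale : forall (a : A) m b, ract (a *: m) b = a *: ract m b;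
  ractR : forall (r : R) m, ract m r%:A = r%:A *: m
}.

#[short(type="bimodType")]
HB.structure Definition Bimodule (R : comPzRingType) (A B : algType R) :=
  {M of GRing.Lmodule A M & Lmodule_isBimodule R A B M}.

Section BimoduleTheory.
Variables (R : comPzRingType) (A B : algType R) (M : bimodType A B).

Definition faithful_left := forall a : A, (forall m : M, a *: m = 0) -> a = 0.

Definition faithful_right := forall b : B, (forall m : M, ract m b = 0) -> b = 0.

Lemma ract0l b : ract (0 : M) b = 0.
Proof. by apply: (addIr (ract 0 b)); rewrite -ractDl !add0r. Qed.

Lemma ract0r (m : M) : ract m (0 : B) = 0.
Proof. by apply: (addIr (ract m 0)); rewrite -ractDr !add0r. Qed.

End BimoduleTheory.

Arguments faithful_left {R A B} M.
Arguments faithful_right {R A B} M.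

Section Triangular.
Variables (R : comPzRingType) (A B : algType R) (M : bimodType A B).

(* [Trian a m b] is the upper triangular matrix with diagonal entries a and b
   and upper right entry m. *)
Record trian := Trian {tri_ul : A; tri_ur : M; tri_lr : B}.

Definition trian_tuple t := (tri_ul t, tri_ur t, tri_lr t).
Definition tuple_trian p := let: (a, m, b) := p in Trian a m b.

Lemma trian_tupleK : cancel trian_tuple tuple_trian.
Proof. by case. Qed.

HB.instance Definition _ := Choice.copy trian (can_type trian_tupleK).

Definition tri_zero := Trian 0 0 0.
Definition tri_opp x := Trian (- tri_ul x) (- tri_ur x) (- tri_lr x).
Definition tri_add x y :=
  Trian (tri_ul x + tri_ul y) (tri_ur x + tri_ur y) (tri_lr x + tri_lr y).

Lemma tri_addA : associative tri_add.
Proof. by case=> [a m b] [c n d] [e p f]; rewrite /tri_add /= !addrA. Qed.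

Lemma tri_addC : commutative tri_add.
Proof.
by case=> [a m b] [c n d]; congr Trian; rewrite /= addrC.
Qed.

Lemma tri_add0 : left_id tri_zero tri_add.
Proof. by case=> [a m b]; rewrite /tri_add /= !add0r. Qed.

Lemma tri_addN : left_inverse tri_zero tri_opp tri_add.
Proof. by case=> [a m b]; rewrite /tri_add /= !addNr. Qed.

HB.instance Definition _ :=
  GRing.isZmodule.Build trian tri_addA tri_addC tri_add0 tri_addN.

Definition tri_one := Trian 1 0 1.
Definition tri_mul x y :=
  Trian (tri_ul x * tri_ul y)
        (tri_ul x *: tri_ur y + ract (tri_ur x) (tri_lr y))
        (tri_lr x * tri_lr y).

Lemma tri_mulA : associative tri_mul.
Proof.
case=> [a m b] [c n d] [e p f]; congr Trian; rewrite /= ?mulrA //.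
by rewrite scalerDr scalerA ractDl ractA ract_scale addrA.
Qed.

Lemma tri_mul1 : left_id tri_one tri_mul.
Proof.
by case=> [a m b]; rewrite /tri_mul /= !mul1r scale1r ract0l addr0.
Qed.

Lemma tri_mulr1 : right_id tri_one tri_mul.
Proof.
by case=> [a m b]; rewrite /tri_mul /= !mulr1 scaler0 ract1 add0r.
Qed.

Lemma tri_mulDl : left_distributive tri_mul +%R.
Proof.
case=> [a m b] [c n d] [e p f]; congr Trian; rewrite /= ?mulrDl //.
by rewrite scalerDl ractDl addrACA.
Qed.

Lemma tri_mulDr : right_distributive tri_mul +%R.
Proof.
case=> [a m b] [c n d] [e p f]; congr Trian; rewrite /= ?mulrDr //.
by rewrite scalerDr ractDr addrACA.
Qed.

Lemma tri_one_neq0 : tri_one != 0.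
Proof. by apply/eqP => -[/eqP]; rewrite oner_eq0. Qed.

HB.instance Definition _ :=
  GRing.Zmodule_isNzRing.Build trian tri_mulA tri_mul1 tri_mulr1
    tri_mulDl tri_mulDr tri_one_neq0.

Definition tri_scale (r : R) x :=
  Trian (r *: tri_ul x) (r%:A *: tri_ur x) (r *: tri_lr x).

Lemma tri_scaleA r s x : tri_scale r (tri_scale s x) = tri_scale (r * s) x.
Proof. by rewrite /tri_scale /= !scalerA -scalerAl mul1r scalerA. Qed.

Lemma tri_scale1 : left_id 1 tri_scale.
Proof. by case=> [a m b]; rewrite /tri_scale /= !scale1r. Qed.

Lemma tri_scaleDr : right_distributive tri_scale +%R.
Proof. by move=> r [a m b] [c n d]; congr Trian; rewrite /= scalerDr. Qed.

Lemma tri_scaleDl x : {morph tri_scale^~ x : r s / r + s}.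
Proof. by move=> r s; congr Trian; rewrite /= !scalerDl. Qed.

HB.instance Definition _ :=
  GRing.Zmodule_isLmodule.Build R trian tri_scaleA tri_scale1
    tri_scaleDr tri_scaleDl.

Lemma tri_scaleAl (r : R) (x y : trian) : r *: (x * y) = (r *: x) * y.
Proof.
case: x y => [a m b] [c n d]; congr Trian; rewrite /= ?scalerAl //.
by rewrite scalerDr scalerA -scalerAl mul1r ract_scale.
Qed.

HB.instance Definition _ := GRing.Lmodule_isLalgebra.Build R trian tri_scaleAl.

Lemma tri_scaleAr (r : R) (x y : trian) : r *: (x * y) = x * (r *: y).
Proof.
case: x y => [a m b] [c n d]; congr Trian; rewrite /= ?scalerAr //.
rewrite scalerDr !scalerA mulr_algl mulr_algr; congr (_ + _).
by rewrite -[r *: d]mulr_algl -ractA ractR ract_scale.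
Qed.

HB.instance Definition _ := GRing.Lalgebra_isAlgebra.Build R trian tri_scaleAr.

End Triangular.

Arguments trian {R A B} M.

Definition trivial_idempotents (S : pzRingType) :=
  forall e : S, e * e = e -> e = 0 \/ e = 1.

Definition central (S : pzRingType) (z : S) := forall x : S, GRing.comm z x.

Definition centralizing (R : comPzRingType) (S : algType R)
    (Theta : {linear S -> S}) :=
  forall x : S, central (x * Theta x - Theta x * x).

(* Main.v *)
Require Import Defs.
From mathcomp Require Import all_boot all_order all_algebra.

Import GRing.Theory.
Local Open Scope ring_scope.

(** Write [p] for the idempotent with upper left entry 1. As A and B have only
    trivial idempotents, the idempotent [sigma p] has diagonal entries 0 or 1,
    and centrality of [p * sigma p - sigma p * p] kills its corner, so
    [sigma p] is one of 0, 1, p, 1 - p. Injectivity excludes the first two, and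
    the last would send the nonzero corner p T (1 - p) into (1 - p) T p = 0.
    Hence [sigma] fixes [p]. The centralizing condition at [p + n], for [n] in
    the corner, then gives [sigma n = n], and comparing [x * n], [n * x] and
    [p * x * (1 - p)] with their images recovers every entry of [sigma x]
    by faithfulness. *)

Section Triangular.
Context {R : comPzRingType} {A B : algType R} {M : bimodType A B}.

Definition tri_p : trian M := Trian 1 0 0.

Definition tri_corner (m : M) : trian M := Trian 0 m 0.

Lemma mul_p_tri (x : trian M) : tri_p * x = Trian (tri_ul x) (tri_ur x) 0.
Proof. by congr Trian; rewrite /= ?mul1r ?mul0r ?scale1r ?ract0l ?addr0. Qed.

Lemma mul_tri_p (x : trian M) : x * tri_p = Trian (tri_ul x) 0 0.
Proof. by congr Trian; rewrite /= ?mulr1 ?mulr0 ?scaler0 ?ract0r ?addr0. Qed.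

Lemma mul_tri_corner (x : trian M) m :
  x * tri_corner m = tri_corner (tri_ul x *: m).
Proof. by congr Trian; rewrite /= ?mulr0 ?ract0r ?addr0. Qed.

Lemma mul_corner_tri (x : trian M) m :
  tri_corner m * x = tri_corner (ract m (tri_lr x)).
Proof. by congr Trian; rewrite /= ?mul0r ?scale0r ?add0r. Qed.

Lemma peirce_corner (x : trian M) :
  tri_p * x * (1 - tri_p) = tri_corner (tri_ur x).
Proof.
rewrite mulrBr mulr1 mul_tri_p mul_p_tri.
by congr Trian; rewrite /= ?subrr ?subr0.
Qed.

Lemma peirce_lower (x : trian M) : (1 - tri_p) * x * tri_p = 0.
Proof.
rewrite mulrBl mul1r mul_p_tri mul_tri_p.
by congr Trian; rewrite /= subrr.
Qed.

(** Test against [tri_p]: left multiplication by it keeps the corner entry, right multiplication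
    kills it. *)
Lemma central_tri_ur (z : trian M) : central z -> tri_ur z = 0.
Proof. by move=> /(_ tri_p); rewrite /GRing.comm mul_p_tri mul_tri_p => -[]. Qed.

Lemma tri_p_neq0 : tri_p <> 0.
Proof. by case=> /eqP; rewrite oner_eq0. Qed.

Lemma tri_p_neq1 : tri_p <> 1.
Proof. by case=> /eqP; rewrite eq_sym oner_eq0. Qed.

Lemma centralizing_p (Theta : {linear trian M -> trian M}) :
  centralizing Theta -> tri_ur (Theta tri_p) = 0.
Proof.
move=> /(_ tri_p)/central_tri_ur.
by rewrite mul_p_tri mul_tri_p /= subr0.
Qed.

Lemma tri_idempotent_diag (e : trian M) :
    trivial_idempotents A -> trivial_idempotents B ->
    e * e = e -> tri_ur e = 0 ->
  [\/ e = 0, e = 1, e = tri_p | e = 1 - tri_p].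
Proof.
case: e => a m b A_idem B_idem -[/A_idem a01 _ /B_idem b01] /= ->.
case: a01 b01 => [->|->] [->|->].
- exact: Or41.
- by apply: Or44; congr Trian; rewrite /= ?subrr ?subr0.
- exact: Or43.
- exact: Or42.
Qed.

(** The corner is cut out by [tri_p] alone, so the image of [tri_p] determines where [sigma] sends
    it. *)
Lemma rmorph_corner (sigma : {rmorphism trian M -> trian M}) (x : trian M) :
  sigma (tri_corner (tri_ur x)) = sigma tri_p * sigma x * (1 - sigma tri_p).
Proof. by rewrite -peirce_corner !rmorphM rmorphB rmorph1. Qed.

Lemma centralizing_fixes_p (sigma : {lrmorphism trian M -> trian M}) :
    (exists m : M, m <> 0) ->
    trivial_idempotents A -> trivial_idempotents B ->
    injective sigma -> centralizing sigma ->
  sigma tri_p = tri_p.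
Proof.
move=> [m m_neq0] A_idem B_idem sigma_inj sigmaC.
have pp : tri_p * tri_p = tri_p by rewrite mul_p_tri.
have ee : sigma tri_p * sigma tri_p = sigma tri_p by rewrite -rmorphM pp.
have [sp|sp|//|sp] :=
  tri_idempotent_diag _ A_idem B_idem ee (centralizing_p _ sigmaC).
- by case: tri_p_neq0; apply: sigma_inj; rewrite rmorph0.
- by case: tri_p_neq1; apply: sigma_inj; rewrite rmorph1.
- have: tri_corner m = 0.
    apply: sigma_inj; rewrite rmorph0 (rmorph_corner sigma (tri_corner m)).
    by rewrite /= sp subKr peirce_lower.
  by case=> /m_neq0.
Qed.

Lemma centralizing_fixes_corner (sigma : {lrmorphism trian M -> trian M}) m :
    centralizing sigma -> sigma tri_p = tri_p ->
  sigma (tri_corner m) = tri_corner m.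
Proof.
move=> sigmaC sp.
have := rmorph_corner sigma (tri_corner m); rewrite /= sp peirce_corner.
(* As [tri_p] is fixed, [sigma] maps the corner to itself; [n] is the corner entry of the image. *)
move: (tri_ur _) => n sn.
have sx : sigma (tri_p + tri_corner m) = tri_p + tri_corner n.
  by rewrite rmorphD /= sp sn.
have /central_tri_ur := sigmaC (tri_p + tri_corner m).
(* [centralizing] speaks of a linear map, so [sx] is recast for the linear map underlying [sigma].
   The commutator of [tri_p + tri_corner m] and [tri_p + tri_corner n] has corner entry [n - m]. *)
rewrite (sx : (sigma : {linear _ -> _}) _ = _) /=.
rewrite !addr0 !add0r !scale1r !ract0r !addr0 => /eqP.
by rewrite subr_eq0 sn => /eqP ->.
Qed.

End Triangular.

Theorem theorem5p3 (R : comPzRingType) (A B : algType R) (M : bimodType A B)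
  (M_neq0 : exists m : M, m <> 0)
  (M_faithful_left : faithful_left M)
  (M_faithful_right : faithful_right M)
  (A_idem : trivial_idempotents A)
  (B_idem : trivial_idempotents B)
  (sigma : {lrmorphism trian M -> trian M})
  (sigma_auto : bijective sigma)
  (sigma_centralizing : centralizing sigma) :
  forall x : trian M, sigma x = x.
Proof.
move=> x.
have sp : sigma tri_p = tri_p.
  exact: centralizing_fixes_p (bij_inj sigma_auto) sigma_centralizing.
have sc m : sigma (tri_corner m) = tri_corner m.
  exact: centralizing_fixes_corner.
have ul_eq : tri_ul (sigma x) = tri_ul x.
  apply/eqP; rewrite -subr_eq0; apply/eqP/M_faithful_left => m.
  (* Both [tri_corner m] and [x * tri_corner m] lie in the corner, hence are fixed. *)
  have: sigma x * tri_corner m = x * tri_corner m.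
    by rewrite -{1}sc -rmorphM mul_tri_corner /= sc.
  by rewrite !mul_tri_corner scalerBl => -[->]; rewrite subrr.
have lr_eq : tri_lr (sigma x) = tri_lr x.
  apply/eqP; rewrite -subr_eq0; apply/eqP/M_faithful_right => m.
  have: tri_corner m * sigma x = tri_corner m * x.
    by rewrite -{1}sc -rmorphM mul_corner_tri /= sc.
  rewrite !mul_corner_tri => -[ract_eq].
  (* Adding this term reduces the claim to [ract_eq] by additivity of [ract m]. *)
  apply: (addIr (ract m (tri_lr x))).
  by rewrite -ractDr subrK add0r.
(* The remaining entry: [sigma] fixes the corner part of [x], which is thus also the corner part of
   [sigma x]. *)
have := rmorph_corner sigma x; rewrite /= sc sp peirce_corner => -[].
by case: x (sigma x) ul_eq lr_eq => [a m b] [c n d] /= -> -> ->.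
Qed.
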